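(* Let $(\Omega,\mathcal F,\{\mathcal F_t\}_{t\ge 0},P)$ be a filtered probability space satisfying the usual conditions, and let $(\Sigma_t)_{t\ge 0}$ be an adapted process of symmetric positive definite $p\times p$ matrices with continuous paths. Fix $d\in\mathbb N$. For $t\in(d-1,d]$ put $\langle t\rangle=t-d+1$ and $A_t=\langle t\rangle^{-1}\int_{d-1}^t\Sigma_s\,ds$ (so $A_t\to\Sigma_{d-1}$ as $t\downarrow d-1$), and assume $A_t$ is invertible for all $t\in(d-1,d]$. Let $G_d(\theta)$ be an $\mathcal F_{d-1}$-measurable symmetric $p\times p$ matrix, let $(Z_t)$ be a symmetric-matrix-valued martingale, and put $M_t=\int_{d-1}^t dZ_s=Z_t-Z_{d-1}$. Suppose that for all $t\in(d-1,d]$, $$\Sigma_t=2A_{t-}-A_{t-}\Sigma_{d-1}^{-1}A_{t-}+(4\langle t\rangle-3\langle t\rangle^2)A_{t-}\big(\Sigma_{d-1}^{-1}-G_d(\theta)\big)A_{t-}-A_{t-}M_tA_{t-}.$$ Then the inverse of the daily integrated volatility matrix satisfies $$\Omega_d:=\Big(\int_{d-1}^d\Sigma_t\,dt\Big)^{-1}=G_d(\theta)+U_d,\qquad U_d=\int_{d-1}^dM_t\,dt,$$ and $U_d$ is a martingale difference, i.e. $E[U_d\mid\mathcal F_{d-1}]=0$ almost surely (provided $U_d$ is integrable).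
   Context: $A_{t-}$ denotes the left limit of $A$ at $t$ (equal to $A_t$ here since $\Sigma$ is continuous). The matrix $\Sigma_t=\sigma_t\sigma_t^\top$ is the spot covariance matrix of a log-price process $dX_t=\mu_t\,dt+\sigma_t\,d\mathcal B_t$ with $\mathcal B_t$ a $p$-dimensional standard Brownian motion. *)

(* Defs.v *)
From HB Require Import structures.
From mathcomp Require Import all_boot all_order all_algebra.
From mathcomp Require Import all_classical all_reals all_analysis.
Set Implicit Arguments. Unset Strict Implicit. Unset Printing Implicit Defensive.
Import Order.TTheory GRing.Theory Num.Theory.
Import numFieldNormedType.Exports.
Local Open Scope classical_set_scope.
Local Open Scope ring_scope.

Section Defs.
Context {R : realType} {d0 : measure_display} {T : measurableType d0}.

Definition sub_sigma (G : set (set T)) : Prop :=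
  sigma_algebra setT G /\ (forall A, G A -> measurable A).

Definition measurable_wrt (G : set (set T)) (X : T -> R) : Prop :=
  forall B : set R, measurable B -> G (X @^-1` B).

Definition is_cond_exp (P : probability T R) (G : set (set T)) (X Y : T -> R) : Prop :=
  [/\ P.-integrable setT (EFin \o X),
      measurable_wrt G Y,
      P.-integrable setT (EFin \o Y) &
      forall B, G B -> (\int[P]_(x in B) (Y x)%:E = \int[P]_(x in B) (X x)%:E)%E].

Definition filtration (F : R -> set (set T)) : Prop :=
  (forall t, 0 <= t -> sub_sigma (F t)) /\
  (forall s t, 0 <= s -> s <= t -> forall A, F s A -> F t A).

Definition usual_conditions (P : probability T R) (F : R -> set (set T)) : Prop :=
  (forall A N, measurable N -> P N = 0%E -> A `<=` N -> measurable A) /\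
  (forall N, measurable N -> P N = 0%E -> F 0 N) /\
  (forall t A, 0 <= t -> (forall s, t < s -> F s A) -> F t A).

Definition adapted_mx {p : nat} (F : R -> set (set T)) (X : R -> T -> 'M[R]_p) :=
  forall t, 0 <= t -> forall i j, measurable_wrt (F t) (fun w => X t w i j).

Definition martingale_mx {p : nat} (P : probability T R) (F : R -> set (set T))
  (Z : R -> T -> 'M[R]_p) : Prop :=
  adapted_mx F Z /\
  (forall s t, 0 <= s -> s <= t -> forall i j,
     is_cond_exp P (F s) (fun w => Z t w i j) (fun w => Z s w i j)).
End Defs.

Definition symmx {R : realType} {p : nat} (S : 'M[R]_p) : Prop := S^T = S.

Definition posdefmx {R : realType} {p : nat} (S : 'M[R]_p) : Prop :=
  symmx S /\ forall x : 'rV[R]_p, x != 0 -> 0 < (x *m S *m x^T) ord0 ord0.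

Definition mx_integral {R : realType} {p : nat} (a b : R) (f : R -> 'M[R]_p) : 'M[R]_p :=
  \matrix_(i, j) Rintegral lebesgue_measure `[a, b] (fun s => f s i j).

(* Main.v *)
(* Write u = t - a with a = d - 1 and B_t = A_t^-1.  Since A' = (S - A)/u and
   B' = - B A' B, conjugating the equation for Sigma by B turns it into the linear
   identity
     ((u B) - u Sigma_a^-1 + (2u^2 - u^3)(Sigma_a^-1 - G))' = M_t.
   The function on the left vanishes as u -> 0 because A_t -> Sigma_a, and equals
   B_d - G at u = 1, so integrating over the day gives the first claim.  The equation also
   exhibits M as a continuous function of t on the closed day, with limit 0 at a.

   For the second claim, E|Z_t| <= E|Z_d| on the day, so M is integrable on the product of
   the probability space and the day (it is jointly measurable because its paths are
   continuous); by Fubini the integral of U over an event of F_a is the time integral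
   of the integrals of M_t over this event, which vanish by the martingale property. *)
Require Import Defs.
From HB Require Import structures.
From mathcomp Require Import all_boot all_order all_algebra.
From mathcomp Require Import all_classical all_reals all_analysis.
From mathcomp Require Import measurable_realfun ring.
Import Order.TTheory GRing.Theory Num.Theory.
Import numFieldNormedType.Exports.
Local Open Scope classical_set_scope.
Local Open Scope ring_scope.

(** * Entrywise limits of matrix functions, up to the inverse *)

Section EntrywiseLimits.
Set Implicit Arguments.
Unset Strict Implicit.
Context {R : realType} {I : Type} {F : set_system I} {FF : Filter F}.

(** Working entry by entry reduces every matrix limit to limits of real functions, in keeping with
    the entrywise integrals and path continuity of the theorem. *)
Definition mx_cvg {m n : nat} (f : I -> 'M[R]_(m, n)) (L : 'M[R]_(m, n)) :=
  forall i j, f x i j @[x --> F] --> L i j.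

Lemma mx_cvg_cst {m n} (L : 'M[R]_(m, n)) : mx_cvg (fun=> L) L.
Proof. by move=> i j; exact: cvg_cst. Qed.

Lemma mx_cvgN {m n} (f : I -> 'M[R]_(m, n)) L :
  mx_cvg f L -> mx_cvg (fun x => - f x) (- L).
Proof.
move=> fL i j; rewrite mxE; under eq_cvg do rewrite mxE.
exact: cvgN (fL i j).
Qed.

Lemma mx_cvgD {m n} (f g : I -> 'M[R]_(m, n)) L K :
  mx_cvg f L -> mx_cvg g K -> mx_cvg (fun x => f x + g x) (L + K).
Proof.
move=> fL gK i j; rewrite mxE; under eq_cvg do rewrite mxE.
exact: cvgD (fL i j) (gK i j).
Qed.

Lemma mx_cvgB {m n} (f g : I -> 'M[R]_(m, n)) L K :
  mx_cvg f L -> mx_cvg g K -> mx_cvg (fun x => f x - g x) (L - K).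
Proof. by move=> fL gK; apply: mx_cvgD => //; exact: mx_cvgN. Qed.

Lemma mx_cvgZ {m n} (k : I -> R) (f : I -> 'M[R]_(m, n)) (l : R) L :
  k x @[x --> F] --> l -> mx_cvg f L -> mx_cvg (fun x => k x *: f x) (l *: L).
Proof.
move=> kl fL i j; rewrite mxE; under eq_cvg do rewrite mxE.
exact: cvgM kl (fL i j).
Qed.

Lemma mx_cvgM {m n q} (f : I -> 'M[R]_(m, n)) (g : I -> 'M[R]_(n, q)) L K :
  mx_cvg f L -> mx_cvg g K -> mx_cvg (fun x => f x *m g x) (L *m K).
Proof.
move=> fL gK i j; rewrite mxE; under eq_cvg do rewrite mxE.
apply: cvg_big => [|k _]; last exact: cvgM (fL i k) (gK k j).
exact: add_continuous.
Qed.

(** The Leibniz formula is a finite sum of signed finite products of entries. *)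
Lemma cvg_det {n} (f : I -> 'M[R]_n) L :
  mx_cvg f L -> \det (f x) @[x --> F] --> \det L.
Proof.
move=> fL; apply: cvg_big => [|s _]; first exact: add_continuous.
apply: cvgM; first exact: cvg_cst.
apply: cvg_big => [|i _]; [exact: mul_continuous|exact: fL].
Qed.

Lemma mx_cvg_adj {n} (f : I -> 'M[R]_n) L :
  mx_cvg f L -> mx_cvg (fun x => \adj (f x)) (\adj L).
Proof.
move=> fL i j; rewrite mxE; under eq_cvg do rewrite mxE.
apply: cvgM; first exact: cvg_cst.
by apply: cvg_det => k l; rewrite !mxE; under eq_cvg do rewrite !mxE; exact: fL.
Qed.

Lemma near_unitmx {n} (f : I -> 'M[R]_n) L :
  mx_cvg f L -> L \in unitmx -> \forall x \near F, f x \in unitmx.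
Proof.
rewrite unitmxE unitfE => fL L0.
have := cvgr_neq0 _ (cvg_det fL).
by move=> /(_ _ L0); apply: filterS => x; rewrite unitmxE unitfE.
Qed.

Lemma mx_cvg_near {m n} (f g : I -> 'M[R]_(m, n)) L :
  (\forall x \near F, f x = g x) -> mx_cvg f L -> mx_cvg g L.
Proof.
move=> fg fL i j; apply: cvg_trans (fL i j); apply: near_eq_cvg.
by apply: filterS fg => x ->.
Qed.

(** Near the limit the determinant is nonzero, so the inverse is the adjugate divided by the
    determinant, and both of these converge. *)
Lemma mx_cvg_inv {n} (f : I -> 'M[R]_n) L :
  mx_cvg f L -> L \in unitmx -> mx_cvg (fun x => invmx (f x)) (invmx L).
Proof.
move=> fL uL.
apply: (mx_cvg_near (f := fun x => (\det (f x))^-1 *: \adj (f x))).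
  by apply: filterS (near_unitmx fL uL) => x ux; rewrite /invmx ux.
rewrite /invmx uL; apply: mx_cvgZ (mx_cvg_adj fL).
by apply: cvgV (cvg_det fL); rewrite -unitfE -unitmxE.
Qed.

End EntrywiseLimits.

Arguments mx_cvg {R I} F {m n} f L.

(** * Entrywise derivatives of matrix functions *)

Section MatrixDerivative.
Set Implicit Arguments.
Unset Strict Implicit.
Context {R : realType}.

Definition mx_derive {m n : nat} (f : R -> 'M[R]_(m, n)) (t : R) (D : 'M[R]_(m, n)) :=
  forall i j, is_derive t 1 (fun s => f s i j) (D i j).

Lemma is_derive_cvgP (f : R -> R) (t l : R) : is_derive t 1 f l <->
  h^-1 * (f (h + t) - f t) @[h --> 0^'] --> l.
Proof.
have E : (fun h => h^-1 * (f (h + t) - f t)) =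
    fun h => h^-1 *: ((f \o shift t) (h *: 1) - f t).
  by apply/funext => h /=; rewrite /GRing.scale /= mulr1.
rewrite {}E; split=> [[df <-]|fl]; first exact: df.
split; first exact: (cvgP l).
exact: cvg_lim.
Qed.

Lemma mx_deriveP {m n} (f : R -> 'M[R]_(m, n)) t D : mx_derive f t D <->
  mx_cvg (0 : R)^' (fun h => h^-1 *: (f (h + t) - f t)) D.
Proof.
have E i j : (fun h => (h^-1 *: (f (h + t) - f t)) i j) =
    fun h => h^-1 * (f (h + t) i j - f t i j).
  by apply/funext => h; rewrite !mxE.
by split=> H i j; have := H i j; rewrite is_derive_cvgP E.
Qed.

Lemma mx_derive_cvg {m n} (f : R -> 'M[R]_(m, n)) t D :
  mx_derive f t D -> mx_cvg (nbhs t) f (f t).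
Proof.
move=> fD i j; have [df _] := fD i j.
exact/differentiable_continuous/derivable1_diffP.
Qed.

(** Divide the identity Y^-1 - X^-1 = - Y^-1 (Y - X) X^-1 by h, with X = [f t] and Y = [f (h + t)],
    and let h tend to 0; [Y] is invertible for small h. *)
Lemma mx_derive_inv {n} (f : R -> 'M[R]_n) t D :
  mx_derive f t D -> f t \in unitmx ->
  mx_derive (fun s => invmx (f s)) t (- (invmx (f t) *m D *m invmx (f t))).
Proof.
move=> fD ut; have fc := mx_derive_cvg fD; apply/mx_deriveP.
have fs : mx_cvg (0 : R)^' (fun h => f (h + t)) (f t).
  move=> i j.
  apply: (@cvg_comp _ _ _ (fun h => h + t) (fun s => f s i j)) (fc i j).
  apply: cvg_within_filter.
  have : (h + t) @[h --> (0:R)] --> (0 + t)%R by apply: cvgD => //; exact: cvg_cst.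
  by rewrite add0r.
apply: (mx_cvg_near (f := fun h =>
  - (invmx (f (h + t)) *m (h^-1 *: (f (h + t) - f t)) *m invmx (f t)))).
  apply: filterS (near_unitmx fs ut) => h uh.
  rewrite -scalemxAr -scalemxAl -scalerN mulmxBr mulmxBl mulVmx // mul1mx opprB.
  by rewrite -mulmxA mulmxV // mulmx1.
apply: mx_cvgN; apply: mx_cvgM; last exact: mx_cvg_cst.
by apply: mx_cvgM; [exact: mx_cvg_inv|exact/mx_deriveP].
Qed.

Lemma mx_deriveD {m n} (f g : R -> 'M[R]_(m, n)) t D E :
  mx_derive f t D -> mx_derive g t E -> mx_derive (fun s => f s + g s) t (D + E).
Proof.
move=> fD gE i j; rewrite mxE.
have -> : (fun s => (f s + g s) i j) = (fun s => f s i j) + (fun s => g s i j).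
  by apply/funext => s; rewrite mxE.
exact: is_deriveD (fD i j) (gE i j).
Qed.

Lemma mx_deriveZ {m n} (k : R -> R) (f : R -> 'M[R]_(m, n)) (t dk : R) D :
  is_derive t 1 k dk -> mx_derive f t D ->
  mx_derive (fun s => k s *: f s) t (k t *: D + dk *: f t).
Proof.
move=> kd fD i j; rewrite !mxE [dk * _]mulrC.
have -> : (fun s => (k s *: f s) i j) = k * (fun s => f s i j).
  by apply/funext => s; rewrite mxE.
exact: is_deriveM kd (fD i j).
Qed.

Lemma mx_derive_cst {m n} (C : 'M[R]_(m, n)) t : mx_derive (fun=> C) t 0.
Proof. by move=> i j; rewrite mxE; exact: is_derive_cst. Qed.

Lemma mx_deriveZr {m n} (k : R -> R) (C : 'M[R]_(m, n)) (t dk : R) :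
  is_derive t 1 k dk -> mx_derive (fun s => k s *: C) t (dk *: C).
Proof.
move=> kd; have := mx_deriveZ kd (mx_derive_cst C t).
by rewrite scaler0 add0r.
Qed.

Lemma subr_cvg_dnbhs (a : R) : (t - a) @[t --> a^'+] --> (0 : R)^'.
Proof.
move=> P [e /= e0 eP].
rewrite !near_simpl; near=> t; apply: eP => /=.
- have ta : 0 <= t - a by rewrite subr_ge0; near: t; exact: nbhs_right_ge.
  rewrite sub0r normrN (ger0_norm ta).
  by rewrite ltrBlDr addrC; near: t; apply: nbhs_right_lt; rewrite ltrDl.
- by rewrite subr_eq0 gt_eqF//; near: t; exact: nbhs_right_gt.
Unshelve. all: by end_near. Qed.

(** Used for the limit of the running average at the start of the day: the average of S over [a, t]
    is the slope from a of an antiderivative of S. *)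
Lemma mx_derive_slope_right {m n} (f : R -> 'M[R]_(m, n)) (a : R) D :
  mx_derive f a D -> mx_cvg a^'+ (fun t => (t - a)^-1 *: (f t - f a)) D.
Proof.
move=> /mx_deriveP fD i j.
have -> : (fun t => ((t - a)^-1 *: (f t - f a)) i j) =
    (fun h => (h^-1 *: (f (h + a) - f a)) i j) \o (fun t => t - a).
  by apply/funext => t /=; rewrite subrK.
exact: cvg_comp (@subr_cvg_dnbhs a) (fD i j).
Qed.

End MatrixDerivative.

(** * The equation along one fixed path: linearisation, continuity of M and integration *)

Section Riccati.
Set Implicit Arguments.
Unset Strict Implicit.
Context {R : realType} {p : nat}.

(** Multiplying by the inverse of X on both sides strips the outer factors X from each quadratic
    term and turns the linear term in X into one in its inverse. *)
Lemma riccati_unconj (X Y W H : 'M[R]_p) (c : R) (G : 'M[R]_p) : X \in unitmx ->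
  W = 2%:R *: X - X *m Y *m X + c *: (X *m (Y - G) *m X) - X *m H *m X ->
  invmx X *m W *m invmx X = 2%:R *: invmx X - Y + c *: (Y - G) - H.
Proof.
move=> u ->; move: (Y - G) => g.
have E V : invmx X *m (X *m V *m X) *m invmx X = V.
  by rewrite !mulmxA mulVmx// mul1mx -mulmxA mulmxV// mulmx1.
rewrite !(mulmxDr, mulmxDl, mulmxN, mulNmx) -!scalemxAr -!scalemxAl !E.
by rewrite mulVmx// mul1mx.
Qed.

(** [N] is an antiderivative of [S], differentiable on both sides even at [a] and [b], so [A] is
    both the running average of [S] and a difference quotient of [N]. *)
Variables (a b : R) (ab : b = a + 1) (S N M : R -> 'M[R]_p) (G : 'M[R]_p).
Let A t := (t - a)^-1 *: (N t - N a).
Let q t : R := 4%:R * (t - a) - 3%:R * (t - a) ^+ 2.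
Hypothesis NS : forall t, a <= t <= b -> mx_derive N t (S t).
Hypothesis cS : forall t, a <= t <= b -> mx_cvg (nbhs t) S (S t).
Hypothesis uA : forall t, a < t <= b -> A t \in unitmx.
Hypothesis uS : S a \in unitmx.
Hypothesis eqS : forall t, a < t <= b ->
  S t = 2%:R *: A t - A t *m invmx (S a) *m A t
      + q t *: (A t *m (invmx (S a) - G) *m A t) - A t *m M t *m A t.
Hypothesis M0 : M a = 0.

Let B t := invmx (A t).
(** The equation solved for M: only [A], [S] and explicit functions of t remain, so the continuity
    of M can be read off. *)
Let Mf t := 2%:R *: B t - invmx (S a) + q t *: (invmx (S a) - G) - B t *m S t *m B t.

Lemma riccati_solve t : a < t <= b -> M t = Mf t.
Proof.
move=> atb; rewrite /Mf /B (riccati_unconj (uA atb) (eqS atb)).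
by rewrite opprB addrC subrK.
Qed.

Let cA t : a < t <= b -> mx_cvg (nbhs t) A (A t).
Proof.
move=> /andP[at_ tb]; apply: mx_cvgZ.
  apply: cvgV; first by rewrite subr_eq0 gt_eqF.
  by apply: cvgB; [exact: cvg_id|exact: cvg_cst].
apply: mx_cvgB; last exact: mx_cvg_cst.
by apply: (mx_derive_cvg (D := S t)); apply: NS; rewrite tb ltW.
Qed.

Let cq t : q s @[s --> t] --> q t.
Proof.
apply: cvgB; apply: cvgM; try exact: cvg_cst.
  by apply: cvgB; [exact: cvg_id|exact: cvg_cst].
by apply: cvgM; apply: cvgB; by [exact: cvg_id|exact: cvg_cst].
Qed.

(** The filter and the limit of [A] are left free in order to cover [a^'+] as well: there [A] tends
    to [S a], whereas the formula gives [A a = 0]. *)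
Let cMf F {FF : Filter F} L : mx_cvg F A L -> L \in unitmx ->
  forall T, mx_cvg F S T -> forall r : R, q s @[s --> F] --> r ->
  mx_cvg F Mf (2%:R *: invmx L - invmx (S a) + r *: (invmx (S a) - G)
     - invmx L *m T *m invmx L).
Proof.
move=> AL uL T ST r qr; have BL : mx_cvg F B (invmx L) := mx_cvg_inv (FF := FF) AL uL.
apply: mx_cvgB; last by apply: mx_cvgM => //; exact: mx_cvgM.
apply: mx_cvgD; last by apply: mx_cvgZ => //; exact: mx_cvg_cst.
apply: mx_cvgB; last exact: mx_cvg_cst.
by apply: mx_cvgZ => //; exact: cvg_cst.
Qed.

Let cMt t : a < t <= b -> mx_cvg (nbhs t) Mf (M t).
Proof.
move=> atb; rewrite riccati_solve//; apply: cMf; [exact: cA|exact: uA| |exact: cq].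
by apply: cS; case/andP: atb => /ltW -> ->.
Qed.

Let ltab : a < b. Proof. by rewrite ab ltrDl. Qed.

Let A_right : mx_cvg a^'+ A (S a).
Proof. by apply/mx_derive_slope_right/NS; rewrite lexx ltW. Qed.

Lemma riccati_continuous i j : {within `[a, b], continuous (fun t => M t i j)}.
Proof.
apply/continuous_within_itvP => //; split.
- move=> t; rewrite in_itv/= => /andP[at_ tb].
  have c : mx_cvg (nbhs t) Mf (M t) by apply: cMt; rewrite at_ ltW.
  apply: (mx_cvg_near _ c).
  near=> s; rewrite riccati_solve//; apply/andP; split.
    by near: s; exact: lt_nbhsr.
  by apply/ltW; near: s; exact: lt_nbhsl.
- have c : mx_cvg a^'+ Mf (M a).
    (* With [A] tending to [S a] and [q a = 0], the limit of [Mf] is 2 - 1 - 1 = 0 times the inverse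
       of [S a], which matches [M a = 0]. *)
    have -> : M a = 2%:R *: invmx (S a) - invmx (S a) + q a *: (invmx (S a) - G)
     - invmx (S a) *m S a *m invmx (S a).
      rewrite /q subrr expr0n/= !mulr0 subrr scale0r addr0 mulVmx// mul1mx M0.
      by rewrite scaler_nat mulr2n addrK subrr.
    apply: cMf => //; last by apply: cvg_within_filter; exact: cq.
    by move=> k l; apply: cvg_within_filter; apply: cS; rewrite lexx ltW.
  apply: (mx_cvg_near _ c); near=> s; rewrite riccati_solve//; apply/andP; split.
    by near: s; exact: nbhs_right_gt.
  by near: s; exact: nbhs_right_le.
- have c : mx_cvg b^'- Mf (M b).
    by move=> k l; apply: cvg_within_filter; apply: cMt; rewrite ltab lexx.
  apply: (mx_cvg_near _ c); near=> s; rewrite riccati_solve//; apply/andP; split.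
    by near: s; exact: nbhs_left_gt.
  by near: s; exact: nbhs_left_le.
Unshelve. all: by end_near. Qed.

(* K vanishes at a and is an antiderivative of M. *)
Let K t := (t - a) *: B t - (t - a) *: invmx (S a)
  + (2%:R * (t - a) ^+ 2 - (t - a) ^+ 3) *: (invmx (S a) - G).

Let dsub (t : R) : is_derive t 1 (fun s : R => s - a) (1 : R).
Proof.
by apply: is_derive_eq; rewrite subr0.
Qed.

Let dA (t : R) : a < t <= b -> mx_derive A t ((t - a)^-1 *: (S t - A t)).
Proof.
move=> /andP[at_ tb]; have u0 : t - a != 0 by rewrite subr_eq0 gt_eqF.
have d1 : mx_derive (fun s => N s - N a) t (S t).
  have := mx_deriveD (NS (t := t) _) (mx_derive_cst (- N a) t).
  by rewrite addr0; apply; rewrite tb ltW.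
have -> : (t - a)^-1 *: (S t - A t) =
    (t - a)^-1 *: S t + (- (t - a) ^- 2 *: (1 : R)) *: (N t - N a).
  rewrite [LHS]scalerBr /A scalerA -scaleNr; congr (_ + _ *: _).
  by rewrite /GRing.scale /= mulr1 -exprVn expr2.
exact: mx_deriveZ (is_deriveV (f := fun s => s - a) u0 (dsub t)) d1.
Qed.

Let dK (t : R) : a < t <= b -> mx_derive K t (M t).
Proof.
move=> atb; have := atb; case/andP => at_ tb.
have u0 : t - a != 0 by rewrite subr_eq0 gt_eqF.
have dB := mx_derive_inv (dA atb) (uA atb).
(* The polynomial 2u^2 - u^3 in [K] is the antiderivative of the weight 4u - 3u^2 that vanishes at u
   = 0. *)
have dp : is_derive t 1 (fun s : R => 2%:R * (s - a) ^+ 2 - (s - a) ^+ 3) (q t).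
  have d := dsub t.
  apply: is_derive_eq; rewrite /q /GRing.scale /=; ring.
have dn : is_derive t 1 (fun s : R => - (s - a)) (-1) by exact: is_deriveN.
have := mx_deriveD (mx_deriveD (mx_deriveZ (dsub t) dB)
  (mx_deriveZr (invmx (S a)) dn)) (mx_deriveZr (invmx (S a) - G) dp).
have -> : (fun s => (s - a) *: invmx (A s) + - (s - a) *: invmx (S a) +
   (2 * (s - a) ^+ 2 - (s - a) ^+ 3) *: (invmx (S a) - G)) = K.
  by apply/funext => s; rewrite /K /B scaleNr.
(* Since u A' = S - A, the term u B' equals - B (S - A) B = B - B S B; the product rule adds another
   B, which gives the 2 B of [Mf]. *)
have E : (t - a) *: - (invmx (A t) *m ((t - a)^-1 *: (S t - A t)) *m invmx (A t))
    = B t - B t *m S t *m B t.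
  rewrite -scalemxAr -scalemxAl scalerN scalerA divff// scale1r.
  by rewrite mulmxBr mulmxBl mulVmx ?uA// mul1mx opprB.
rewrite E scale1r scaleN1r riccati_solve// /Mf scaler_nat mulr2n.
congr mx_derive; rewrite [RHS]addrAC; congr (_ + _).
by rewrite [RHS]addrAC; congr (_ + _); rewrite addrAC.
Qed.

Let cK t : a < t <= b -> mx_cvg (nbhs t) K (K t).
Proof. by move=> /dK; exact: mx_derive_cvg. Qed.

Let K_right : mx_cvg a^'+ K (K a).
Proof.
have s0 : (s - a) @[s --> a^'+] --> (0 : R).
  rewrite -[X in _ --> X](subrr a); apply: cvg_within_filter.
  by apply: cvgB; [exact: cvg_id|exact: cvg_cst].
(* In [K a] the value [B a] is multiplied by 0, so it may be replaced by the limit of [B] from the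
   right. *)
have -> : K a = 0 *: invmx (S a) - 0 *: invmx (S a)
    + (2%:R * (0 * 0) - (0 * (0 * 0))) *: (invmx (S a) - G).
  by rewrite /K (subrr a) !scale0r.
apply: mx_cvgD.
  apply: mx_cvgB; apply: mx_cvgZ => //; last exact: mx_cvg_cst.
  by apply: mx_cvg_inv; [exact: A_right|exact: uS].
apply: mx_cvgZ; last exact: mx_cvg_cst.
apply: cvgB; first by apply: cvgM; [exact: cvg_cst|exact: cvgM].
by apply: cvgM => //; exact: cvgM.
Qed.

(** The fundamental theorem of calculus gives [K b - K a] with [K a = 0]. At u = 1 the polynomial
    2u^2 - u^3 equals 1, so the two copies of [invmx (S a)] in [K b] cancel. *)
Lemma riccati_integral : mx_integral a b M = invmx (N b - N a) - G.
Proof.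
have -> : invmx (N b - N a) - G = K b - K a.
  have ba : b - a = 1 by rewrite ab addrAC subrr add0r.
  rewrite /K /B /A ba (subrr a) invr1 !scale1r !scale0r subrr.
  rewrite !expr1n !expr0n/= mulr0 (subrr 0) scale0r addr0 subr0 mulr1.
  by rewrite mulr2n addrK scale1r addrA subrK.
apply/matrixP => i j; rewrite [LHS]mxE /Rintegral.
rewrite (@continuous_FTC2 _ _ (fun t => K t i j)) //.
- by rewrite [RHS]mxE [X in _ = _ + X]mxE.
- exact: riccati_continuous.
- split; [|exact: K_right|].
  + move=> t; rewrite in_itv/= => /andP[at_ tb].
    by have [] := @dK t _ i j; rewrite ?at_ ?ltW.
  + by apply: cvg_within_filter; apply: cK; rewrite ltab lexx.
- move=> t; rewrite in_itv/= => /andP[at_ tb]; rewrite derive1E.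
  by have [] := @dK t _ i j; rewrite ?at_ ?ltW.
Qed.
End Riccati.

(** * Two-sided differentiable primitives of the volatility paths *)

Section Primitive.
Set Implicit Arguments.
Unset Strict Implicit.
Context {R : realType}.
Local Notation mu := (@lebesgue_measure R).

(* Extending f to the left of 0 makes its primitive differentiable on both sides at
   a = 0, where the hypotheses only give one-sided continuity. *)
Definition ext_nneg (f : R -> R) (t : R) : R := f (Num.max t 0).

(** Starting at [a - 1] puts [a] in the interior of the interval of integration; the extra piece
    cancels in differences. *)
Definition primitive (a : R) (f : R -> R) (t : R) : R :=
  \int[mu]_(s in `[a - 1, t]) ext_nneg f s.

Lemma ext_nnegE (f : R -> R) t : 0 <= t -> ext_nneg f t = f t.
Proof. by move=> t0; rewrite /ext_nneg max_l. Qed.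

Lemma continuous_ext_nneg (f : R -> R) : {within `[0, +oo[, continuous f} ->
  continuous (ext_nneg f).
Proof.
move=> /subspace_continuousP cf t.
have t0 : `[0, +oo[%classic (Num.max t 0) by rewrite /= in_itv/= andbT le_max lexx orbT.
apply: (@cvg_comp _ _ _ (fun s => Num.max s 0) f) (cf _ t0).
move=> B HB.
have mc : Num.max s 0 @[s --> t] --> Num.max t 0.
  by apply: (@continuous_max R _ id (cst 0)); [exact: cvg_id|exact: cvg_cst].
have := mc _ HB; rewrite !near_simpl; apply: filterS => s; apply.
by rewrite /= in_itv/= andbT le_max lexx orbT.
Qed.

Lemma integrable_ext_nneg (f : R -> R) a b : {within `[0, +oo[, continuous f} ->
  mu.-integrable `[a, b] (EFin \o ext_nneg f).
Proof.
move=> cf; apply: continuous_compact_integrable; first exact: segment_compact.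
exact/continuous_subspaceT/continuous_ext_nneg.
Qed.

Lemma is_derive_primitive (f : R -> R) (a t : R) : {within `[0, +oo[, continuous f} ->
  a <= t -> is_derive t 1 (primitive a f) (ext_nneg f t).
Proof.
move=> cf at_; have ig := integrable_ext_nneg (a - 1) (t + 1) cf.
have cg : continuous (ext_nneg f) by exact: continuous_ext_nneg.
have t1 : t < t + 1 by rewrite ltrDl.
have a1 : a - 1 < t by rewrite ltrBlDr (le_lt_trans at_).
have [d <-] := continuous_FTC1_closed t1 ig a1 (cg t).
by rewrite derive1E; exact: derivableP.
Qed.

Lemma primitiveB (f : R -> R) (a t : R) : {within `[0, +oo[, continuous f} ->
  0 <= a -> a <= t -> \int[mu]_(s in `[a, t]) f s = primitive a f t - primitive a f a.
Proof.
move=> cf a0 at_; have a1 : a - 1 <= a by rewrite gerBl.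
rewrite /primitive Rintegral_itvB; [|exact: integrable_ext_nneg|by []|by []].
rewrite Rintegral_itv_obnd_cbnd.
  apply: eq_Rintegral => s; rewrite inE/= in_itv/= => /andP[as_ _].
  by rewrite ext_nnegE// (le_trans a0).
apply: integrableS (integrable_ext_nneg a t cf) => //.
by apply: subset_itvr; rewrite bnd_simp.
Qed.

End Primitive.

(** * Joint measurability, L1 bounds and Fubini for the time integral of a martingale *)

Section MartingaleTimeIntegral.
Set Implicit Arguments.
Unset Strict Implicit.
Context {R : realType} {d0 : measure_display} {T : measurableType d0}.
Local Notation mu := (@lebesgue_measure R).

Lemma floor_grid_cvg (t : R) :
  (Num.floor (n.+1%:R * t))%:~R / n.+1%:R @[n --> \oo] --> t.
Proof.
apply/cvgrPdist_lt => e e0; near=> n.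
have n0 : 0 < n.+1%:R :> R by rewrite ltr0n.
have /andP[h1 h2] := floor_itv (n.+1%:R * t).
have -> : t - (Num.floor (n.+1%:R * t))%:~R / n.+1%:R =
   (n.+1%:R * t - (Num.floor (n.+1%:R * t))%:~R) / n.+1%:R.
  by field; rewrite gt_eqF.
rewrite normrM ger0_norm ?subr_ge0// gtr0_norm ?invr_gt0//.
apply: (@le_lt_trans _ _ (1 / n.+1%:R)).
  rewrite ler_pM2r ?invr_gt0// lerBlDr addrC; apply: ltW.
  by move: h2; rewrite intrD.
by rewrite div1r; near: n; exact: (near_infty_natSinv_lt (PosNum e0)).
Unshelve. all: by end_near. Qed.

(* Caratheodory: f is the pointwise limit of the functions obtained by rounding
   t down to the grid of mesh 1/(n+1), whose preimages are countable unions of rectangles. *)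
Lemma measurable_fun_caratheodory (f : T -> R -> R) :
  (forall t, measurable_fun setT (f ^~ t)) -> (forall w, continuous (f w)) ->
  measurable_fun setT (fun z : T * R => f z.1 z.2).
Proof.
move=> mf cf.
pose g (n : nat) (z : T * R) := f z.1 ((Num.floor (n.+1%:R * z.2))%:~R / n.+1%:R).
apply: (@measurable_fun_cvg _ _ _ _ g) => [n _ B mB|[w t] _]; last first.
  by apply: (cvg_comp (fun n : nat => (Num.floor (n.+1%:R * t))%:~R / n.+1%:R) (f w));
    [exact: floor_grid_cvg|exact: cf].
rewrite setTI.
have n0 : 0 < n.+1%:R :> R by rewrite ltr0n.
have -> : g n @^-1` B = \bigcup_(k : int)
    ((f ^~ (k%:~R / n.+1%:R) @^-1` B) `*` `[k%:~R / n.+1%:R, (k + 1)%:~R / n.+1%:R[).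
  apply/seteqP; split => [[w t] /= Bg|[w t] [k _] [/= Bk]].
    exists (Num.floor (n.+1%:R * t)) => //; split => //=; rewrite in_itv/=.
    by rewrite ler_pdivrMr// ltr_pdivlMr// ![t * _]mulrC floor_itv.
  rewrite in_itv/= ler_pdivrMr// ltr_pdivlMr// ![t * _]mulrC => /floor_def fk.
  by rewrite /g /= fk.
apply: countable_bigcupT_measurable => [|k]; first exact: countableP.
apply: measurableX; last exact: measurable_itv.
by rewrite -[X in measurable X]setTI; exact: mf.
Qed.

Lemma measurable_fun_wrt (G : set (set T)) (X : T -> R) :
  sub_sigma G -> measurable_wrt G X -> measurable_fun setT X.
Proof. by move=> [_ GT] mX _ B mB; rewrite setTI; exact/GT/mX. Qed.

Local Open Scope ereal_scope.

(* Y has constant sign on {Y >= 0} and on its complement, which both belong to G, so that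
   on each of them Y can be replaced by X before taking absolute values. *)
Lemma cond_exp_L1 (P : probability T R) (G : set (set T)) (X Y : T -> R) :
  sub_sigma G -> is_cond_exp P G X Y ->
  \int[P]_w `|(Y w)%:E| <= \int[P]_w `|(X w)%:E|.
Proof.
move=> sG [iX mY iY XY]; have mY' := measurable_fun_wrt sG mY.
have [sigG GT] := sG; have [_ GC _] := sigG.
pose E := Y @^-1` `[0%R, +oo[.
have GE : G E by apply: mY; exact: measurable_itv.
have GE' : G (~` E) by rewrite -setTD; exact: GC.
have mE := GT _ GE; have mE' := GT _ GE'.
have split_int (h : T -> R) : measurable_fun setT h -> \int[P]_w `|(h w)%:E| =
    \int[P]_(w in E) `|(h w)%:E| + \int[P]_(w in ~` E) `|(h w)%:E|.
  move=> mh; rewrite -integral_setU ?setUv//.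
    by apply/measurable_EFinP; exact: measurableT_comp mh.
  by apply/disj_set2P; rewrite setICr.
have mX : measurable_fun setT X by apply/measurable_EFinP; exact: measurable_int iX.
have mXE : measurable_fun setT (EFin \o X) by exact/measurable_EFinP.
rewrite split_int// [leRHS]split_int//; apply: leeD.
- have -> : \int[P]_(w in E) `|(Y w)%:E| = \int[P]_(w in E) (Y w)%:E.
    apply: eq_integral => w; rewrite inE /E/= in_itv/= andbT => Y0.
    by rewrite ger0_norm.
  rewrite XY//; apply: le_trans (lee_abs _) _; apply: le_abse_integral => //.
  exact: measurable_funTS.
- have -> : \int[P]_(w in ~` E) `|(Y w)%:E| = - \int[P]_(w in ~` E) (Y w)%:E.
    rewrite -integralN.
      apply: eq_integral => w; rewrite inE /E/= in_itv/= andbT => /negP.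
      by rewrite -ltNge => Y0; rewrite ltr0_norm.
    by apply: integrable_add_def => //; exact: integrableS iY.
  rewrite XY//; apply: le_trans (lee_abs _) _; rewrite abseN.
  by apply: le_abse_integral => //; exact: measurable_funTS.
Qed.

(** After exchanging the two integrals, the inner one vanishes for each t: [A] lies in [F a], hence
    in [F t], so [X t] and [X a] have the same integral over [A] as [X b]. *)
Lemma integral_itv_martingale_increment (P : probability T R)
    (F : R -> set (set T)) (X : R -> T -> R) (a b : R) (A : set T) :
  (a <= b)%R ->
  (forall t, (a <= t <= b)%R -> sub_sigma (F t)) ->
  (forall t, (a <= t <= b)%R -> F a `<=` F t) ->
  (forall t, (a <= t <= b)%R -> is_cond_exp P (F t) (X b) (X t)) ->
  (forall w, {within `[a, b], continuous (fun t => X t w)}) ->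
  F a A ->
  \int[P]_(w in A) (\int[mu]_(t in `[a, b]) (X t w - X a w)%R)%R%:E = 0.
Proof.
move=> ab sF FaF ceX cX FA.
have aab : (a <= a <= b)%R by rewrite lexx.
have [_ _ iXa Xa] := ceX a aab; have mA := (sF a aab).2 _ FA.
have mX t : (a <= t <= b)%R -> measurable_fun setT (X t).
  by move=> tab; have [_ m _ _] := ceX t tab; exact: measurable_fun_wrt (sF t tab) m.
have iX t : (a <= t <= b)%R -> P.-integrable setT (EFin \o X t) by move=> /ceX[].
(* Clamping time to [a, b] extends the increment to a function continuous on the whole line, as
   [measurable_fun_caratheodory] requires. *)
pose clamp t := Num.max a (Num.min t b).
have clampP t : (a <= clamp t <= b)%R.
  by rewrite /clamp le_max lexx /= ge_max ab ge_min lexx orbT.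
have clampE t : (a <= t <= b)%R -> clamp t = t.
  by move=> /andP[at_ tb]; rewrite /clamp min_l// max_r.
have cclamp : continuous clamp.
  move=> t; apply: (@continuous_max _ _ (cst a) (fun t => Num.min t b)).
    exact: cvg_cst.
  by apply: (@continuous_min _ _ id (cst b)); [exact: cvg_id|exact: cvg_cst].
pose Y w t : R := (X (clamp t) w - X a w)%R.
have cY w : continuous (Y w).
  move=> t; apply: cvgB; last exact: cvg_cst.
  have /subspace_continuousP/(_ (clamp t)) := cX w.
  rewrite /= in_itv/= => /(_ (clampP t)) c.
  apply: (@cvg_comp _ _ _ clamp (X ^~ w)) c => B HB.
  have := cclamp t _ HB; rewrite !near_simpl; apply: filterS => s; apply.
  by rewrite /= in_itv/=.
have mY : measurable_fun setT (fun z : T * R => Y z.1 z.2).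
  apply: measurable_fun_caratheodory => // t.
  by apply: measurable_funB; apply: mX.
(* Extension by zero outside A x [a, b] allows Fubini on the full product space. *)
pose Phi := (fun z : T * R => (Y z.1 z.2)%:E) \_ (A `*` `[a, b]).
have mPhi : measurable_fun setT Phi.
  apply/(measurable_restrictT _ (measurableX mA (measurable_itv _))).
  by apply: measurable_funTS; exact/measurable_EFinP.
have PhiE w t : Phi (w, t) = ((fun w => ((fun t => (Y w t)%:E) \_ `[a, b]) t) \_ A) w.
  rewrite /Phi /patch /= in_setX; case: (w \in A) => //=.
have inner t : t \in `[a, b]%classic -> \int[P]_w Phi (w, t) = 0.
  rewrite inE/= in_itv/= => tab.
  under eq_integral do rewrite PhiE.
  rewrite -integral_mkcond.
  rewrite (eq_integral (fun w => (X t w)%:E - (X a w)%:E)); last first.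
    by move=> w _; rewrite /patch mem_set/= ?in_itv//= /Y clampE.
  have iA s : (a <= s <= b)%R -> P.-integrable A (fun w => (X s w)%:E).
    by move=> sab; apply: integrableS (iX s sab).
  rewrite integralB//; try exact: iA.
  have [_ _ _ Xt] := ceX t tab.
  rewrite Xt; last exact: (FaF t tab).
  rewrite Xa// subee//; apply: integrable_fin_num => //; apply: iA.
  by rewrite ab lexx.
have innerN t : t \notin `[a, b]%classic -> \int[P]_w Phi (w, t) = 0.
  move=> tab; apply: integral0_eq => w _.
  by rewrite PhiE /patch (negbTE tab); case: ifP.
have iPhi : (P \x mu).-integrable setT Phi.
  apply/integrable21ltyP => //.
  (* By [cond_exp_L1] the expectation of |X t - X a| is at most [C] for every t of the day, so the
     double integral is at most [C] times b - a. *)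
  pose C := \int[P]_w `|(X b w)%:E| + \int[P]_w `|(X a w)%:E|.
  have bab : (a <= b <= b)%R by rewrite ab lexx.
  have C0 : 0 <= C by rewrite adde_ge0// integral_ge0.
  have Cfin : C \is a fin_num.
    rewrite ge0_fin_numE// lte_add_pinfty//; first by case/integrableP: (iX b bab).
    by case/integrableP: iXa.
  have mPhia : measurable_fun setT (fun z => `|Phi z|) by exact: measurableT_comp.
  apply: (@le_lt_trans _ _ (\int[mu]_t ((cst C) \_ `[a, b]) t)); last first.
    rewrite -integral_mkcond integral_cst// lte_mul_pinfty//.
    have : mu (`[a, b]%classic : set R) < +oo; last by [].
    by rewrite lebesgue_measure_itv/=; case: ifP => // _; rewrite -EFinB ltry.
  apply: ge0_le_integral => //.
  - by move=> t _; exact: integral_ge0.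
  - exact: (measurable_fun_fubini_tonelli_G (m1 := P) (fun z => `|Phi z|) mPhia).
  - by apply/(measurable_restrictT _ (measurable_itv _)).
  - move=> t _; rewrite /patch; case: ifPn => [tI|tab]; last first.
      rewrite le_eqVlt; apply/orP; left; apply/eqP; apply: integral0_eq => w _.
      by rewrite PhiE /patch (negbTE tab); case: ifP => _; rewrite abse0.
    have tab : (a <= t <= b)%R by move: tI; rewrite inE/= in_itv.
    have mabs s : (a <= s <= b)%R -> measurable_fun setT (fun w => `|(X s w)%:E|).
      by move=> sab; apply/measurable_EFinP; exact: measurableT_comp (mX s sab).
    apply: (@le_trans _ _ (\int[P]_w (`|(X t w)%:E| + `|(X a w)%:E|))); last first.
      rewrite ge0_integralD//; [|exact: mabs|exact: mabs].
      by rewrite leeD2r// (cond_exp_L1 (sF t tab))//; exact: ceX.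
    apply: ge0_le_integral => //.
    + exact: (measurableT_comp mPhia (pair2_measurable t)).
    + by apply: emeasurable_funD; exact: mabs.
    + move=> w _; rewrite PhiE /patch tI.
      case: ifP => _; last by rewrite abse0 adde_ge0.
      by rewrite /Y clampE// -EFinD lee_fin; exact: ler_normB.
transitivity (\int[P]_w \int[mu]_t Phi (w, t)).
  rewrite integral_mkcond; apply: eq_integral => w _.
  rewrite [LHS]/patch; case: ifPn => wA; last first.
    by rewrite integral0_eq// => t _; rewrite PhiE /patch (negbTE wA).
  have -> : \int[mu]_t Phi (w, t) = \int[mu]_t ((fun t => (Y w t)%:E) \_ `[a, b]) t.
    by apply: eq_integral => t _; rewrite PhiE {1}/patch wA.
  rewrite -integral_mkcond /Rintegral.
  have YE : {in `[a, b]%classic, (fun t => (X t w - X a w)%R) =1 Y w}.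
    by move=> t; rewrite inE/= in_itv/= => tab; rewrite /Y clampE.
  (* The real-valued time integral is the extended one only where that is finite; here the integrand
     is continuous on a compact interval. *)
  rewrite fineK; first by apply: eq_integral => t /YE ->.
  have -> : \int[mu]_(t in `[a, b]) (X t w - X a w)%:E = \int[mu]_(t in `[a, b]) (Y w t)%:E.
    by apply: eq_integral => t /YE ->.
  apply: integrable_fin_num => //; apply: continuous_compact_integrable.
    exact: segment_compact.
  exact: continuous_subspaceT (cY w).
rewrite (Fubini iPhi); apply: integral0_eq => t _.
by case: (boolP (t \in `[a, b]%classic)) => [/inner|/innerN].
Qed.

End MartingaleTimeIntegral.

(** * Invertibility of the spot volatility and assembly of the two claims *)

Lemma posdefmx_unit {R : realType} {p : nat} (S : 'M[R]_p) :
  posdefmx S -> S \in unitmx.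
Proof.
(* A nonzero row x with x S = 0 would make the quadratic form vanish at x. *)
move=> [_ pos]; rewrite -row_free_unit -kermx_eq0; apply/negPn/negP => /rowV0Pn[x].
by move=> /sub_kermxP xS /pos; rewrite xS mul0mx mxE ltxx.
Qed.

Theorem theorem1 (R : realType) (d0 : measure_display) (T : measurableType d0)
  (P : probability T R) (F : R -> set (set T)) (p : nat)
  (Sigma : R -> T -> 'M[R]_p) (d : nat) (G : T -> 'M[R]_p)
  (Z : R -> T -> 'M[R]_p) :
  filtration F -> usual_conditions P F ->
  adapted_mx F Sigma ->
  (forall t w, 0 <= t -> posdefmx (Sigma t w)) ->
  (forall w i j, {within `[0, +oo[, continuous (fun t => Sigma t w i j)}) ->
  (1 <= d)%N ->
  let a := d%:R - 1 in
  let br := fun t : R => t - d%:R + 1 in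
  let A := fun t w => (br t)^-1 *: mx_integral a t (fun s => Sigma s w) in
  (forall t w, a < t <= d%:R -> A t w \in unitmx) ->
  (forall i j, measurable_wrt (F a) (fun w => G w i j)) ->
  (forall w, symmx (G w)) ->
  (forall t w, 0 <= t -> symmx (Z t w)) ->
  martingale_mx P F Z ->
  let M := fun t w => Z t w - Z a w in
  (forall t w, a < t <= d%:R ->
     Sigma t w = 2%:R *: A t w - A t w *m invmx (Sigma a w) *m A t w
       + (4%:R * br t - 3%:R * br t ^+ 2) *:
           (A t w *m (invmx (Sigma a w) - G w) *m A t w)
       - A t w *m M t w *m A t w) ->
  let U := fun w => mx_integral a d%:R (fun t => M t w) in
  (forall i j, P.-integrable setT (fun w => (U w i j)%:E)) ->
  (forall w, invmx (mx_integral a d%:R (fun t => Sigma t w)) = G w + U w) /\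
  (forall i j, is_cond_exp P (F a) (fun w => U w i j) (fun _ => 0)).
Proof.
move=> filtF _ _ posS cS d1 a br A uA _ _ _ martZ M eqS U iU.
have a0 : 0 <= a by rewrite subr_ge0 ler1n.
have ab : d%:R = a + 1 by rewrite subrK.
have brE t : br t = t - a by rewrite /br /a opprB addrA addrAC.
have ltab : a < d%:R by rewrite ab ltrDl.
(* For each path w, [N w] and [S w] come from the extended path, which supplies the two-sided
   derivatives and limits at [a] even when [a = 0]. *)
pose N w t : 'M[R]_p := \matrix_(i, j) primitive a (fun s => Sigma s w i j) t.
pose S w t : 'M[R]_p := \matrix_(i, j) ext_nneg (fun s => Sigma s w i j) t.
have NE w t : a <= t -> mx_integral a t (fun s => Sigma s w) = N w t - N w a.
  by move=> at_; apply/matrixP => i j; rewrite !mxE primitiveB.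
have SE w t : 0 <= t -> S w t = Sigma t w.
  by move=> t0; apply/matrixP => i j; rewrite mxE ext_nnegE.
have NS w t : a <= t <= d%:R -> mx_derive (N w) t (S w t).
  move=> /andP[at_ _] i j; rewrite mxE.
  have -> : (fun s => N w s i j) = primitive a (fun s => Sigma s w i j).
    by apply/funext => s; rewrite mxE.
  exact: is_derive_primitive.
have cSw w t : a <= t <= d%:R -> mx_cvg (nbhs t) (S w) (S w t).
  move=> _ i j; rewrite mxE.
  have -> : (fun s => S w s i j) = ext_nneg (fun s => Sigma s w i j).
    by apply/funext => s; rewrite mxE.
  exact: continuous_ext_nneg.
have AE w t : a < t <= d%:R -> A t w = (t - a)^-1 *: (N w t - N w a).
  by move=> /andP[at_ _]; rewrite /A brE NE// ltW.
have uAw w t : a < t <= d%:R -> (t - a)^-1 *: (N w t - N w a) \in unitmx.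
  by move=> atd; rewrite -AE//; exact: uA.
have uSw w : S w a \in unitmx by rewrite SE//; exact/posdefmx_unit/posS.
have eqSw w t : a < t <= d%:R -> let At := (t - a)^-1 *: (N w t - N w a) in
    S w t = 2%:R *: At - At *m invmx (S w a) *m At
      + (4%:R * (t - a) - 3%:R * (t - a) ^+ 2) *:
          (At *m (invmx (S w a) - G w) *m At) - At *m M t w *m At.
  move=> atd /=; have [at_ _] := andP atd.
  by rewrite -AE// !SE ?(le_trans a0 (ltW at_))// (eqS t w atd) brE.
have M0 w : M a w = 0 by rewrite /M subrr.
have cM w i j : {within `[a, d%:R], continuous (fun t => M t w i j)}.
  exact: (riccati_continuous ab (NS w) (cSw w) (uAw w) (uSw w) (eqSw w) (M0 w)).
split=> [w|i j].
  rewrite /U (riccati_integral ab (NS w) (cSw w) (uAw w) (uSw w) (eqSw w) (M0 w)).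
  by rewrite addrC subrK NE// ltW.
have [sF incF] := filtF.
have [[F0 FC _] _] := sF a a0.
have FT : F a setT by rewrite -(setD0 setT); exact: FC.
split.
- exact: iU.
(* Preimages under a constant are empty or the whole space, and both lie in [F a]. *)
- by move=> B _; rewrite preimage_cst; case: ifP.
- exact: integrable0.
- move=> B FB; rewrite integral0_eq//; apply/esym.
  (* Path continuity of Z on the closed day is inherited from M, for which it was derived from the
     equation. *)
  have cZ w : {within `[a, d%:R], continuous (fun t => Z t w i j)}.
    have -> : (fun t => Z t w i j) = (fun t => M t w i j + Z a w i j).
      by apply/funext => t; rewrite /M !mxE subrK.
    by move=> t; apply: cvgD; [exact: cM|exact: cvg_cst].
  have := @integral_itv_martingale_increment R d0 T P F (fun t w => Z t w i j)
    a d%:R B (ltW ltab).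
  have -> : (fun w => (\int[lebesgue_measure]_(t in `[a, d%:R])
      (Z t w i j - Z a w i j))%:E) = (fun w => (U w i j)%:E).
    apply/funext => w; rewrite mxE; congr EFin.
    by apply: eq_Rintegral => t _; rewrite /M !mxE.
  apply => //.
  + by move=> t /andP[at_ _]; apply: sF; exact: le_trans at_.
  + by move=> t /andP[at_ _]; exact: incF.
  + by move=> t /andP[at_ td]; apply: martZ.2 => //; exact: le_trans at_.
Qed.
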